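(* Let $\{p_\theta:\theta\in\Theta\}$ be a family of densities on a sample space $\mathcal{X}$, let $\pi$ be a prior density on $\Theta$, with the likelihood satisfying $\int\int p_\theta(x)^2\,p_\theta(x)\pi(\theta)\,dx\,d\theta<\infty$, and let $m(x)=\int p_\theta(x)\pi(\theta)\,d\theta$. Let $\mathcal{U}:\Delta_m\to\Gamma_\pi$, $(\mathcal{U}\delta)(\theta)=E_\theta\delta(X)$, be the unbiasedness operator and $\mathcal{B}_\pi:\Gamma_\pi\to\Delta_m$, $(\mathcal{B}_\pi\gamma)(x)=E(\gamma(\theta)\mid x)$, be the Bayes operator. Then $\mathcal{U}$ and $\mathcal{B}_\pi$ are adjoint operators of each other: for every $\gamma\in\Gamma_\pi$ and every $\delta\in\Delta_m$, $$(\gamma,\mathcal{U}\delta)_\pi=(\mathcal{B}_\pi\gamma,\delta)_m .$$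
   Context: The random variable $X$ takes values in $\mathcal{X}$ and has density $p_\theta(\cdot)$ when the parameter is $\theta\in\Theta$; $\pi$ is a fixed prior (probability) density on $\Theta$; $dx$ and $d\theta$ denote the underlying $\sigma$-finite reference measures on $\mathcal{X}$ and $\Theta$ (integrals are sums in the discrete case), and $(x,\theta)\mapsto p_\theta(x)$ is jointly measurable. The marginal density of $X$ is $m(x)=\int p_\theta(x)\pi(\theta)\,d\theta$ and the posterior density is $\pi(\theta\mid x)=p_\theta(x)\pi(\theta)/m(x)$ (defined where $m(x)>0$). $\Gamma_\pi=\{\gamma:\Theta\to\mathbb{R}:\int\gamma^2(\theta)\pi(\theta)\,d\theta<\infty\}$ is the Hilbert space with inner product $(\gamma_1,\gamma_2)_\pi=\int_\Theta\gamma_1(\theta)\gamma_2(\theta)\pi(\theta)\,d\theta$. $\Delta_m=\{\delta:\mathcal{X}\to\mathbb{R}:\int\delta^2(x)m(x)\,dx<\infty\}$ is the Hilbert space with inner product $(\delta_1,\delta_2)_m=\int_{\mathcal{X}}\delta_1(x)\delta_2(x)m(x)\,dx$. As usual, functions in these spaces are identified when they agree almost everywhere for the corresponding weighted measure. $E_\theta\delta(X)=\int\delta(x)p_\theta(x)\,dx$ and $E(\gamma(\theta)\mid x)=\int\gamma(\theta)\pi(\theta\mid x)\,d\theta$. *)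

(* Defs.v *)
From HB Require Import structures.
From mathcomp Require Import all_boot all_order all_algebra.
From mathcomp Require Import all_classical all_reals all_analysis.

Set Implicit Arguments.
Unset Strict Implicit.
Unset Printing Implicit Defensive.
Import Order.TTheory GRing.Theory Num.Theory.
Import numFieldNormedType.Exports.

Local Open Scope classical_set_scope.
Local Open Scope ring_scope.

Section WeightedL2.
Context (d : measure_display) (T : measurableType d) (R : realType).
Variables (mu : {measure set T -> \bar R}) (w : T -> \bar R).

(* The weights are extended-real because a marginal density
   [\int p_theta(x) prior(theta) dtheta] may be infinite on a null set. *)

Definition weighted (A : set T) : \bar R := (\int[mu]_(x in A) w x)%E.

Definition L2w : set (T -> R) :=
  [set f : T -> R | measurable_fun setT f /\
           (\int[mu]_x (((f x) ^+ 2)%:E * w x) < +oo)%E].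

Definition innerw (f g : T -> R) : R :=
  fine (\int[mu]_x ((f x * g x)%:E * w x))%E.

(* The elements of the Hilbert space are the classes of [L2w] for [eqw]. *)
Definition eqw (f g : T -> R) : Prop := {ae weighted, forall x, f x = g x}.

End WeightedL2.

(* [A], given on representatives, induces a linear operator between the
   Hilbert spaces of classes of functions modulo [eqw]. *)
Definition is_operator (d1 d2 : measure_display)
    (T1 : measurableType d1) (T2 : measurableType d2) (R : realType)
    (mu1 : {measure set T1 -> \bar R}) (w1 : T1 -> \bar R)
    (mu2 : {measure set T2 -> \bar R}) (w2 : T2 -> \bar R)
    (A : (T1 -> R) -> (T2 -> R)) : Prop :=
  [/\ (forall f, L2w mu1 w1 f -> L2w mu2 w2 (A f)),
      (forall f g, L2w mu1 w1 f -> L2w mu1 w1 g ->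
         eqw mu1 w1 f g -> eqw mu2 w2 (A f) (A g)) &
      (forall (a : R) f g, L2w mu1 w1 f -> L2w mu1 w1 g ->
         eqw mu2 w2 (A (fun x => a * f x + g x))
                    (fun y => a * A f y + A g y))].

Definition is_density (d : measure_display) (T : measurableType d)
    (R : realType) (mu : {measure set T -> \bar R}) (f : T -> R) : Prop :=
  [/\ measurable_fun setT f, (forall x, 0 <= f x) &
      (\int[mu]_x (f x)%:E = 1)%E].

Section Model.
Context (dX dT : measure_display)
  (X : measurableType dX) (Theta : measurableType dT) (R : realType).
Variables (mu : {measure set X -> \bar R}) (nu : {measure set Theta -> \bar R}).
Variables (p : Theta -> X -> R) (prior : Theta -> R).

Definition marginal (x : X) : \bar R :=
  (\int[nu]_theta (p theta x * prior theta)%:E)%E.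

(* Set to 0 off the set where [0 < marginal x < +oo], which is a null set of
   the measure with density [marginal]: where [marginal x = +oo] the quotient
   is [_ / 0 = 0]. *)
Definition posterior (x : X) (theta : Theta) : R :=
  if (0 < marginal x)%E then p theta x * prior theta / fine (marginal x)
  else 0.

Definition Gamma_prior : set (Theta -> R) := L2w nu (EFin \o prior).
Definition inner_prior : (Theta -> R) -> (Theta -> R) -> R :=
  innerw nu (EFin \o prior).

Definition Delta_marginal : set (X -> R) := L2w mu marginal.
Definition inner_marginal : (X -> R) -> (X -> R) -> R := innerw mu marginal.

(* Both operators take an arbitrary value at the (almost surely non-existing)
   points where the integrand is not integrable. *)
Definition unbiasedness (delta : X -> R) (theta : Theta) : R :=
  Rintegral mu setT (fun x => delta x * p theta x).

Definition Bayes (gamma : Theta -> R) (x : X) : R :=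
  Rintegral nu setT (fun theta => gamma theta * posterior x theta).

End Model.

(* Main.v *)
Require Import Defs.
From HB Require Import structures.
From mathcomp Require Import all_boot all_order all_algebra.
From mathcomp Require Import all_classical all_reals all_analysis.
From mathcomp Require Import measurable_realfun.
From mathcomp Require Import ring lra.
Set Implicit Arguments.
Unset Strict Implicit.
Unset Printing Implicit Defensive.
Import Order.TTheory GRing.Theory Num.Theory.
Import numFieldNormedType.Exports.
Local Open Scope classical_set_scope.
Local Open Scope ring_scope.

(** Both operators integrate a function against a nonnegative kernel of total
    mass at most 1: [unbiasedness] has the kernel [p theta x] from [Theta] to
    [X], and [Bayes] has the kernel [posterior x theta] from [X] to [Theta].
    They are therefore treated together as instances of [kernel_op].

    Let [k s t] be such a kernel, [w] a weight on the points [s] and [v]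
    a weight on the points [t] with [\int k s t * w s ds <= v t].  Jensen's
    inequality (here the Cauchy-Schwarz inequality against [k s]) bounds the
    square of [kernel_op f s] by [second_moment f s], the integral of [f ^ 2]
    against [k s], and Tonelli's theorem gives
      [\int second_moment f s * w s ds <= \int f t ^ 2 * v t dt].
    So [kernel_op] is a contraction from the weighted L2 space of [v] to that of
    [w] ([kernel_op_contraction]).  Almost everywhere existence of the integrals
    follows because [second_moment f] is finite almost everywhere, and
    compatibility with almost everywhere equality follows from linearity and
    contraction, since [f = g] almost everywhere means that [f - g] has norm 0.
    For [p] and [posterior] the condition on the weights reads
    [\int p theta x * prior theta dtheta <= m x] and
    [\int posterior x theta * m x dx <= prior theta].

    The two operators are adjoint because, by Bayes' rule ([bayes_rule]),
    [p theta x * prior theta = posterior x theta * m x] almost everywhere: both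
    inner products are the integral of [gamma theta * delta x] against this
    common joint density, taken in the two orders of integration
    ([kernel_op_adjoint]).  Fubini's theorem applies because
    [|gamma * delta| <= gamma ^ 2 + delta ^ 2], and both squares are integrable
    against the joint density. *)

(** * Almost everywhere statements for a weighted measure *)

Section WeightedAE.
Context (d : measure_display) (T : measurableType d) (R : realType).
Variables (mu : {measure set T -> \bar R}) (w : T -> \bar R).
Hypotheses (mw : measurable_fun setT w) (w0 : forall x, (0 <= w x)%E).

Lemma weighted_eq0 (A : set T) : measurable A ->
  weighted mu w A = 0%E <-> {ae mu, forall x, A x -> w x = 0%E}.
Proof.
move=> mA; have := ae_eq_integral_abs mu mA (measurable_funTS mw).
have -> : (\int[mu]_(x in A) `|w x| = weighted mu w A)%E.
  by apply: eq_integral => x _; rewrite gee0_abs.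
by [].
Qed.

(** Points where the weight vanishes are negligible for the weighted measure,
    and elsewhere it has the same null sets as [mu]; this reduces every
    statement about [weighted mu w], which is a bare set function, to one about
    the filter [almost_everywhere mu]. *)
Lemma ae_weightedP (P : T -> Prop) :
  {ae weighted mu w, forall x, P x} <-> {ae mu, forall x, w x != 0%E -> P x}.
Proof.
split=> [[A [mA /(weighted_eq0 mA) A0 PA]]|[N [mN N0 PN]]].
  apply: filterS A0 => x wx; apply: contraNP => nPx.
  by apply/eqP/wx/PA.
have mZ : measurable [set x | w x = 0%E].
  by have := mw measurableT (emeasurable_set1 0%E); rewrite setTI.
(* Adding the zero set of [w] to [N] leaves the weighted measure null. *)
exists (N `|` [set x | w x = 0%E]); split.
- exact: measurableU.
- apply/weighted_eq0; first exact: measurableU.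
  exists N; split => // x /= /not_implyP[[]//].
- move=> x /= nPx; have [->|wx0] := eqVneq (w x) 0%E; first by right.
  by left; apply: PN => /= /(_ wx0).
Qed.

Lemma ae_weighted_lty (F : T -> \bar R) :
    measurable_fun setT F -> (forall x, (0 <= F x)%E) ->
    (\int[mu]_x (F x * w x) < +oo)%E ->
  {ae mu, forall x, w x != 0%E -> (F x < +oo)%E}.
Proof.
move=> mF F0 Foo.
have Fw0 x : (0 <= F x * w x)%E by exact: mule_ge0.
have : mu.-integrable setT (F \* w)%E.
  apply/integrableP; split; first exact: emeasurable_funM.
  by under eq_integral do rewrite gee0_abs//.
move=> /(integrable_ae measurableT); apply: filterS => x /(_ I) /= + wx0.
rewrite ge0_fin_numE// !ltey; apply: contra => /eqP ->.
by rewrite gt0_mulye// lt0e wx0 w0.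
Qed.

Lemma ae_weighted_eq0 (f : T -> R) : measurable_fun setT f ->
  (\int[mu]_x (((f x) ^+ 2)%:E * w x) = 0)%E <->
  {ae mu, forall x, w x != 0%E -> f x = 0}.
Proof.
move=> mf.
have -> : (\int[mu]_x (((f x) ^+ 2)%:E * w x) =
    \int[mu]_x `|((f x) ^+ 2)%:E * w x|)%E.
  by apply: eq_integral => x _; rewrite gee0_abs// mule_ge0// lee_fin sqr_ge0.
rewrite ae_eq_integral_abs//; last first.
  by apply: emeasurable_funM => //; apply/measurable_EFinP/measurable_funX.
split; apply: filterS => x /=.
  move=> /(_ I)/eqP; rewrite mule_eq0 => /orP[|->//].
  by rewrite eqe sqrf_eq0 => /eqP.
move=> + _; have [->|_ /(_ isT) ->] := eqVneq (w x) 0%E; first by rewrite mule0.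
by rewrite expr0n mul0e.
Qed.

End WeightedAE.

(** * Operators defined by a sub-Markov kernel *)

Lemma measurable_partial_integral (dS dT : measure_display)
    (S : measurableType dS) (T : measurableType dT) (R : realType)
    (nu : {sigma_finite_measure set T -> \bar R}) (F : S * T -> \bar R) :
  measurable_fun setT F ->
  measurable_fun setT (fun s => \int[nu]_t F (s, t))%E.
Proof.
move=> mF.
rewrite (_ : (fun _ => _) = (fun s => \int[nu]_t F^\+ (s, t)) \-
                            (fun s => \int[nu]_t F^\- (s, t)))%E; last first.
  apply/funext => s; rewrite integralE -[fun t => F (s, t)]/(F \o pair s).
  by rewrite funepos_comp funeneg_comp.
apply: emeasurable_funB.
- apply: (measurable_fun_fubini_tonelli_F (F^\+)%E) => //.
  exact: measurable_funepos.
- apply: (measurable_fun_fubini_tonelli_F (F^\-)%E) => //.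
  exact: measurable_funeneg.
Qed.

Section KernelOperator.
Context (dS dT : measure_display) (S : measurableType dS) (T : measurableType dT)
  (R : realType).
Variables (mu : {sigma_finite_measure set S -> \bar R})
  (nu : {sigma_finite_measure set T -> \bar R}).
Variables (k : S -> T -> R) (w : S -> \bar R) (v : T -> \bar R).
Hypothesis mk : measurable_fun [set: S * T] (fun z : S * T => k z.1 z.2).
Hypothesis k0 : forall s t, 0 <= k s t.
Hypothesis k1 : forall s, (\int[nu]_t (k s t)%:E <= 1)%E.
Hypotheses (mw : measurable_fun setT w) (w0 : forall s, (0 <= w s)%E).
Hypotheses (mv : measurable_fun setT v) (v0 : forall t, (0 <= v t)%E).
Hypothesis kwv : forall t, (\int[mu]_s ((k s t)%:E * w s) <= v t)%E.

Definition kernel_op (f : T -> R) (s : S) : R :=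
  Rintegral nu setT (fun t => f t * k s t).

Definition second_moment (f : T -> R) (s : S) : \bar R :=
  (\int[nu]_t ((f t) ^+ 2 * k s t)%:E)%E.

Lemma measurable_kernel s : measurable_fun setT (k s).
Proof. exact: (measurableT_comp mk (pair1_measurable s)). Qed.

Lemma measurable_integrand (f : T -> R) : measurable_fun setT f ->
  measurable_fun [set: S * T] (fun z : S * T => f z.2 * k z.1 z.2).
Proof.
by move=> mf; apply: measurable_funM => //; apply: (measurableT_comp mf).
Qed.

Lemma measurable_sqr_integrand (f : T -> R) : measurable_fun setT f ->
  measurable_fun [set: S * T] (fun z : S * T => ((f z.2) ^+ 2 * k z.1 z.2)%:E).
Proof.
move=> mf; apply/measurable_EFinP.
have mf2 : measurable_fun setT (fun t => f t ^+ 2) by exact: measurable_funX.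
exact: (measurable_integrand mf2).
Qed.

Lemma measurable_second_moment (f : T -> R) : measurable_fun setT f ->
  measurable_fun setT (second_moment f).
Proof.
move=> mf; apply: (measurable_fun_fubini_tonelli_F
  (fun z : S * T => ((f z.2) ^+ 2 * k z.1 z.2)%:E)).
- exact: measurable_sqr_integrand.
- by move=> z; rewrite lee_fin mulr_ge0// sqr_ge0.
Qed.

Lemma second_moment_ge0 (f : T -> R) s : (0 <= second_moment f s)%E.
Proof.
by apply: integral_ge0 => t _; rewrite lee_fin mulr_ge0// sqr_ge0.
Qed.

Lemma measurable_kernel_op (f : T -> R) : measurable_fun setT f ->
  measurable_fun setT (kernel_op f).
Proof.
move=> /measurable_integrand /measurable_EFinP /measurable_partial_integral mG.
have mfine := @fine_measurable R setT measurableT.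
exact: (measurableT_comp mfine (mG nu)).
Qed.

(** Tonelli's theorem: integrating first in [s] turns the kernel and the weight
    [w] into at most the weight [v]. *)
Lemma integral_second_moment_le (f : T -> R) : measurable_fun setT f ->
  (\int[mu]_s (second_moment f s * w s) <= \int[nu]_t (((f t) ^+ 2)%:E * v t))%E.
Proof.
move=> mf.
have mfk s : measurable_fun setT (fun t => ((f t) ^+ 2 * k s t)%:E).
  apply/measurable_EFinP/measurable_funM; first exact: measurable_funX.
  exact: measurable_kernel.
pose F (z : S * T) : \bar R := (((f z.2) ^+ 2 * k z.1 z.2)%:E * w z.1)%E.
have mF : measurable_fun setT F.
  apply: emeasurable_funM; last exact: (measurableT_comp mw).
  exact: measurable_sqr_integrand.
have F0 z : (0 <= F z)%E by rewrite mule_ge0// lee_fin mulr_ge0// sqr_ge0.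
have -> : (\int[mu]_s (second_moment f s * w s) =
           \int[mu]_s \int[nu]_t F (s, t))%E.
  apply: eq_integral => s _; rewrite /second_moment -ge0_integralZr//.
  by move=> t _; rewrite lee_fin mulr_ge0// sqr_ge0.
rewrite fubini_tonelli//; apply: ge0_le_integral => //.
- by move=> t _; exact: integral_ge0.
- exact: measurable_fun_fubini_tonelli_G.
- by apply: emeasurable_funM => //; apply/measurable_EFinP/measurable_funX.
- move=> t _; rewrite /F/=.
  under eq_integral do rewrite EFinM -muleA.
  rewrite ge0_integralZl//.
  + by rewrite lee_wpmul2l// lee_fin sqr_ge0.
  + apply: emeasurable_funM => //; apply/measurable_EFinP.
    exact: (measurableT_comp mk (pair2_measurable t)).
  + by move=> s _; rewrite mule_ge0// lee_fin.
  + by rewrite lee_fin sqr_ge0.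
Qed.

Lemma integrable_kernel s : nu.-integrable setT (fun t => (k s t)%:E).
Proof.
apply/integrableP; split; first exact/measurable_EFinP/measurable_kernel.
under eq_integral do rewrite gee0_abs ?lee_fin//.
by apply: le_lt_trans (k1 s) _; rewrite ltry.
Qed.

Lemma integrable_second_moment (f : T -> R) s : measurable_fun setT f ->
  (second_moment f s < +oo)%E ->
  nu.-integrable setT (fun t => ((f t) ^+ 2 * k s t)%:E).
Proof.
move=> mf foo; apply/integrableP; split.
  by apply/measurable_EFinP/measurable_funM;
    [exact: measurable_funX|exact: measurable_kernel].
rewrite (eq_integral (fun t => ((f t) ^+ 2 * k s t)%:E))// => t _.
by rewrite gee0_abs// lee_fin mulr_ge0// sqr_ge0.
Qed.

(** From [|f| <= 1 + f ^ 2], and the finite mass of [k s]. *)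
Lemma integrable_kernel_op (f : T -> R) s : measurable_fun setT f ->
  (second_moment f s < +oo)%E -> nu.-integrable setT (fun t => (f t * k s t)%:E).
Proof.
move=> mf foo.
have kD := integrableD measurableT (integrable_kernel s)
  (integrable_second_moment mf foo).
apply: le_integrable kD => //.
  by apply/measurable_EFinP/measurable_funM => //; exact: measurable_kernel.
move=> t _; rewrite /= lee_fin -[X in `|X + _|]mul1r -mulrDl !normrM.
rewrite ler_wpM2r// [leRHS]ger0_norm ?addr_ge0 ?sqr_ge0//.
by rewrite ler_norml; apply/andP; split; nra.
Qed.

(** Jensen's inequality.  With [a = kernel_op f s], integrating the pointwise
    inequality [2 * a * f <= f ^ 2 + a ^ 2] against [k s] gives
    [2 * a ^ 2 <= second_moment f s + a ^ 2], as [k s] has mass at most 1.  When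
    the second moment is infinite there is nothing to prove, so the default
    value of [kernel_op f s] at a point of divergence does no harm. *)
Lemma kernel_op_sqr_le (f : T -> R) s : measurable_fun setT f ->
  (((kernel_op f s) ^+ 2)%:E <= second_moment f s)%E.
Proof.
move=> mf; have [foo|] := ltP (second_moment f s) +oo%E; last first.
  by rewrite leye_eq => /eqP ->; rewrite leey.
have intf := integrable_kernel_op mf foo.
have intf2 := integrable_second_moment mf foo.
set a := kernel_op f s.
have intak : nu.-integrable setT (EFin \o (fun t => a ^+ 2 * k s t)).
  exact: (integrableZl measurableT (a ^+ 2) (integrable_kernel s)).
have [k1fin M1] : Rintegral nu setT (k s) <= 1 /\
    second_moment f s = (Rintegral nu setT (fun t => (f t) ^+ 2 * k s t))%:E.
  rewrite /Rintegral; split.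
    have kfin := integrable_fin_num measurableT (integrable_kernel s).
    by rewrite -lee_fin fineK// k1.
  by rewrite fineK//; exact: integrable_fin_num.
rewrite M1 lee_fin.
have : Rintegral nu setT (fun t => 2 * a * (f t * k s t)) <=
       Rintegral nu setT (fun t => (f t) ^+ 2 * k s t + a ^+ 2 * k s t).
  apply: le_Rintegral => //.
  - exact: (integrableZl measurableT (2 * a) intf).
  - exact: (integrableD measurableT intf2 intak).
  - move=> t _; rewrite mulrA -mulrDl ler_wpM2r//.
    by have := sqr_ge0 (a - f t); nra.
rewrite RintegralZl// RintegralD//.
rewrite RintegralZl//; last exact: integrable_kernel.
rewrite -[Rintegral _ _ (fun x => f x * k s x)]/(kernel_op f s) -/a.
have := sqr_ge0 a; nra.
Qed.

Lemma kernel_op_contraction (f : T -> R) : measurable_fun setT f ->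
  (\int[mu]_s (((kernel_op f s) ^+ 2)%:E * w s) <=
   \int[nu]_t (((f t) ^+ 2)%:E * v t))%E.
Proof.
move=> mf; apply: le_trans (integral_second_moment_le mf).
apply: ge0_le_integral => //.
- by move=> s _; rewrite mule_ge0// lee_fin sqr_ge0.
- apply: emeasurable_funM => //; apply/measurable_EFinP/measurable_funX.
  exact: measurable_kernel_op.
- by apply: emeasurable_funM => //; exact: measurable_second_moment.
- by move=> s _; rewrite lee_wpmul2r//; exact: kernel_op_sqr_le.
Qed.

Lemma ae_second_moment_lty (f : T -> R) : L2w nu v f ->
  {ae mu, forall s, w s != 0%E -> (second_moment f s < +oo)%E}.
Proof.
move=> [mf foo]; apply: ae_weighted_lty => //.
- exact: measurable_second_moment.
- by move=> s; exact: second_moment_ge0.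
- exact: le_lt_trans (integral_second_moment_le mf) foo.
Qed.

Lemma ae_integrable_kernel_op (f : T -> R) : L2w nu v f ->
  {ae weighted mu w, forall s, nu.-integrable setT (fun t => (f t * k s t)%:E)}.
Proof.
move=> Lf; have [mf _] := Lf; apply/ae_weightedP => //.
apply: filterS (ae_second_moment_lty Lf) => s /[apply].
exact: integrable_kernel_op.
Qed.

Lemma ae_kernel_op_linear (a : R) (f g : T -> R) : L2w nu v f -> L2w nu v g ->
  {ae mu, forall s, w s != 0%E ->
    kernel_op (fun t => a * f t + g t) s = a * kernel_op f s + kernel_op g s}.
Proof.
move=> /ae_integrable_kernel_op /(ae_weightedP _ mw w0) intf.
move=> /ae_integrable_kernel_op /(ae_weightedP _ mw w0) intg.
apply: filterS2 intf intg => s + + ws => /(_ ws) intf /(_ ws) intg.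
rewrite /kernel_op -RintegralZl// -RintegralD//.
  by apply: eq_Rintegral => t _; rewrite mulrDl mulrA.
exact: (integrableZl measurableT a intf).
Qed.

(** Well-definedness on classes comes from the contraction property: the
    difference [h] of two representatives has norm 0, hence so has
    [kernel_op h], which is almost everywhere the difference of the images. *)
Lemma kernel_op_is_operator : is_operator nu v mu w kernel_op.
Proof.
split=> [f [mf foo]|f g Lf Lg fg|a f g Lf Lg].
- split; first exact: measurable_kernel_op.
  exact: le_lt_trans (kernel_op_contraction mf) foo.
- have [[mf _] [mg _]] := (Lf, Lg).
  pose h t := -1 * f t + g t.
  have mh : measurable_fun setT h.
    by apply: measurable_funD => //; apply: measurable_funM.
  have h0 : (\int[nu]_t (((h t) ^+ 2)%:E * v t) = 0)%E.
    apply/ae_weighted_eq0 => //; move/ae_weightedP : fg => /(_ mv v0).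
    by apply: filterS => t /[apply] fgt; rewrite /h fgt mulN1r addNr.
  have Kh0 : (\int[mu]_s (((kernel_op h s) ^+ 2)%:E * w s) = 0)%E.
    apply/eqP; rewrite eq_le; apply/andP; split.
      by rewrite -h0; exact: kernel_op_contraction.
    by apply: integral_ge0 => s _; rewrite mule_ge0// lee_fin sqr_ge0.
  apply/ae_weightedP => //.
  move/ae_weighted_eq0 : Kh0 => /(_ mw w0 (measurable_kernel_op mh)) Kh0.
  apply: filterS2 Kh0 (ae_kernel_op_linear (-1) Lf Lg) => s + + ws.
  move=> /(_ ws) + /(_ ws); rewrite -/h => -> /eqP.
  by rewrite mulN1r eq_sym addrC subr_eq0 eq_sym => /eqP.
- by apply/ae_weightedP => //; exact: ae_kernel_op_linear.
Qed.

(** The weight stays an extended real, since a marginal density may be infinite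
    on a null set. *)
Definition joint_integrand (f : T -> R) (g : S -> R) (z : S * T) : \bar R :=
  ((g z.1 * (f z.2 * k z.1 z.2))%:E * w z.1)%E.

Lemma measurable_joint_integrand (f : T -> R) (g : S -> R) :
  measurable_fun setT f -> measurable_fun setT g ->
  measurable_fun setT (joint_integrand f g).
Proof.
move=> mf mg; apply: emeasurable_funM; last exact: (measurableT_comp mw).
apply/measurable_EFinP/measurable_funM; first exact: (measurableT_comp mg).
exact: measurable_integrand.
Qed.

(** From [|g * f| <= g ^ 2 + f ^ 2]: the first square contributes at most the
    squared norm of [g] because [k s] has mass at most 1, the second at most
    that of [f] by [integral_second_moment_le]. *)
Lemma integrable_joint_integrand (f : T -> R) (g : S -> R) :
  L2w nu v f -> L2w mu w g ->
  (mu \x nu)%E.-integrable setT (joint_integrand f g).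
Proof.
move=> [mf foo] [mg goo].
have mh := measurable_joint_integrand mf mg.
have mf2 := measurable_second_moment mf.
have mg2 : measurable_fun setT (fun s => ((g s) ^+ 2)%:E).
  exact/measurable_EFinP/measurable_funX.
apply/(integrable12ltyP _ _ mh).
apply: (@le_lt_trans _ _
    (\int[mu]_s (((g s) ^+ 2)%:E * w s + second_moment f s * w s))%E).
  apply: ge0_le_integral => //.
  - by move=> s _; exact: integral_ge0.
  - apply: (measurable_fun_fubini_tonelli_F (abse \o joint_integrand f g)).
      exact: measurableT_comp.
    by move=> z; exact: abse_ge0.
  - by apply: emeasurable_funD; exact: emeasurable_funM.
  - move=> s _.
    have mgk : measurable_fun setT (fun t => ((g s) ^+ 2)%:E * (k s t)%:E)%E.
      by apply: measurable_funeM; apply/measurable_EFinP/measurable_kernel.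
    have mfk : measurable_fun setT (fun t => ((f t) ^+ 2 * k s t)%:E).
      exact: (measurableT_comp (measurable_sqr_integrand mf) (pair1_measurable s)).
    have gk0 t : (0 <= ((g s) ^+ 2)%:E * (k s t)%:E)%E.
      by rewrite -EFinM lee_fin mulr_ge0// sqr_ge0.
    have fk0 t : (0 <= ((f t) ^+ 2 * k s t)%:E)%E.
      by rewrite lee_fin mulr_ge0// sqr_ge0.
    apply: (@le_trans _ _ (\int[nu]_t
        ((((g s) ^+ 2)%:E * (k s t)%:E + ((f t) ^+ 2 * k s t)%:E) * w s))%E).
      apply: ge0_le_integral => //.
      + exact: (measurableT_comp (measurableT_comp _ mh) (pair1_measurable s)).
      + apply: emeasurable_funM; last exact: measurable_cst.
        exact: emeasurable_funD.
      + move=> t _; rewrite /joint_integrand/= abseM (gee0_abs (w0 s)).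
        rewrite lee_wpmul2r//= -EFinM -EFinD lee_fin -mulrDl mulrA normrM.
        rewrite (ger0_norm (k0 s t)) ler_wpM2r// ler_norml.
        have := sqr_ge0 (g s - f t); have := sqr_ge0 (g s + f t).
        by move=> ? ?; apply/andP; split; nra.
    rewrite ge0_integralZr//; last 2 first.
      + exact: emeasurable_funD.
      + by move=> t _; exact: adde_ge0.
    rewrite ge0_integralD// ge0_integralZl//; last 3 first.
      + exact/measurable_EFinP/measurable_kernel.
      + by move=> t _; rewrite lee_fin.
      + by rewrite lee_fin sqr_ge0.
    rewrite -ge0_muleDl; [|by rewrite lee_fin sqr_ge0|exact: second_moment_ge0].
    rewrite lee_wpmul2r// leeD2r// -[leRHS]mule1 lee_wpmul2l// lee_fin.
    exact: sqr_ge0.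
rewrite ge0_integralD//; last 4 first.
- by move=> s _; rewrite mule_ge0// lee_fin sqr_ge0.
- exact: emeasurable_funM.
- by move=> s _; rewrite mule_ge0//; exact: second_moment_ge0.
- exact: emeasurable_funM.
rewrite lte_add_pinfty//.
exact: le_lt_trans (integral_second_moment_le mf) foo.
Qed.

(** Where [w s] is nonzero and finite, [f] is integrable against [k s] for
    almost every [s], so the constant factor [g s * w s] passes under the inner
    integral; where [w s = 0] both sides vanish. *)
Lemma integral_kernel_op (f : T -> R) (g : S -> R) :
  {ae mu, forall s, (w s < +oo)%E} ->
  L2w nu v f -> L2w mu w g ->
  (\int[mu]_s ((g s * kernel_op f s)%:E * w s) =
   \int[mu]_s \int[nu]_t joint_integrand f g (s, t))%E.
Proof.
move=> woo Lf Lg; have [[mf _] [mg _]] := (Lf, Lg).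
apply: ae_eq_integral => //.
- apply: emeasurable_funM => //; apply/measurable_EFinP/measurable_funM => //.
  exact: measurable_kernel_op.
- exact: measurable_partial_integral (measurable_joint_integrand mf mg).
apply: filterS2 woo (ae_second_moment_lty Lf) => s wsoo foo _.
rewrite /joint_integrand/=; have [ws0|ws0] := eqVneq (w s) 0%E.
  by rewrite ws0 mule0; under eq_integral do rewrite mule0; rewrite integral0.
have intf := integrable_kernel_op mf (foo ws0).
have wsE : w s = (fine (w s))%:E by rewrite fineK// ge0_fin_numE.
rewrite wsE; under eq_integral do rewrite EFinM muleC.
rewrite integralZl//; last exact: (integrableZl measurableT).
have KE : (\int[nu]_t (f t * k s t)%:E = (kernel_op f s)%:E)%E.
  by rewrite fineK//; exact: (integrable_fin_num measurableT intf).
by rewrite integralZl// KE muleC EFinM.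
Qed.

End KernelOperator.

(** * Adjointness of two kernels in balance *)

Section Adjoint.
Context (dS dT : measure_display) (S : measurableType dS) (T : measurableType dT)
  (R : realType).
Variables (mu : {sigma_finite_measure set S -> \bar R})
  (nu : {sigma_finite_measure set T -> \bar R}).
Variables (k : S -> T -> R) (l : T -> S -> R) (w : S -> \bar R) (v : T -> \bar R).
Hypothesis mk : measurable_fun [set: S * T] (fun z : S * T => k z.1 z.2).
Hypothesis ml : measurable_fun [set: T * S] (fun z : T * S => l z.1 z.2).
Hypotheses (k0 : forall s t, 0 <= k s t) (l0 : forall t s, 0 <= l t s).
Hypothesis k1 : forall s, (\int[nu]_t (k s t)%:E <= 1)%E.
Hypothesis l1 : forall t, (\int[mu]_s (l t s)%:E <= 1)%E.
Hypotheses (mw : measurable_fun setT w) (w0 : forall s, (0 <= w s)%E).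
Hypotheses (mv : measurable_fun setT v) (v0 : forall t, (0 <= v t)%E).
Hypothesis kwv : forall t, (\int[mu]_s ((k s t)%:E * w s) <= v t)%E.
Hypothesis lvw : forall s, (\int[nu]_t ((l t s)%:E * v t) <= w s)%E.
Hypothesis woo : {ae mu, forall s, (w s < +oo)%E}.
Hypothesis voo : {ae nu, forall t, (v t < +oo)%E}.
(* The two kernels disintegrate the same joint density on [S * T]. *)
Hypothesis balance : {ae nu, forall t,
  {ae mu, forall s, ((k s t)%:E * w s = (l t s)%:E * v t)%E}}.

(** By [integral_kernel_op] the two sides are iterated integrals of
    [g s * f t] against the common joint density, in opposite orders. *)
Lemma kernel_op_adjoint (f : T -> R) (g : S -> R) :
  L2w nu v f -> L2w mu w g ->
  innerw mu w g (kernel_op nu k f) = innerw nu v (kernel_op mu l g) f.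
Proof.
move=> Lf Lg; have [[mf _] [mg _]] := (Lf, Lg); congr fine.
under [RHS]eq_integral do rewrite mulrC.
rewrite (integral_kernel_op mk k0 k1 mw w0 mv kwv)//.
rewrite (integral_kernel_op ml l0 l1 mv v0 mw lvw)//.
rewrite Fubini; last exact: (integrable_joint_integrand mk k0 k1 mw w0 mv kwv).
have mkfg := measurable_joint_integrand mk mw mf mg.
have mlgf := measurable_joint_integrand ml mv mg mf.
apply: ae_eq_integral => //.
- exact: (measurable_partial_integral mu
    (measurableT_comp mkfg (@measurable_swap _ _ T S))).
- exact: measurable_partial_integral mlgf.
apply: filterS balance => t bal _; apply: ae_eq_integral => //.
- exact: (measurableT_comp mkfg (pair2_measurable t)).
- exact: (measurableT_comp mlgf (pair1_measurable t)).
apply: filterS bal => s bal _; rewrite /joint_integrand/= !mulrA.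
by rewrite EFinM -muleA bal muleA -EFinM (mulrC (g s)).
Qed.

End Adjoint.

(** * The likelihood and the posterior as kernels *)

Section BayesModel.
Context (R : realType) (dX dT : measure_display)
  (X : measurableType dX) (Theta : measurableType dT).
Variables (mu : {sigma_finite_measure set X -> \bar R})
  (nu : {sigma_finite_measure set Theta -> \bar R}).
Variables (p : Theta -> X -> R) (prior : Theta -> R).
Hypothesis p_meas : measurable_fun [set: X * Theta]
  (fun z : X * Theta => p z.2 z.1).
Hypothesis p_density : forall theta, is_density mu (p theta).
Hypothesis prior_density : is_density nu prior.

Local Notation m := (marginal nu p prior).
Local Notation post := (posterior nu p prior).

Let p_ge0 theta x : 0 <= p theta x. Proof. by have [] := p_density theta. Qed.

Let prior_ge0 theta : 0 <= prior theta. Proof. by have [] := prior_density. Qed.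

Let prior_meas : measurable_fun setT prior.
Proof. by have [] := prior_density. Qed.

Let joint_meas : measurable_fun [set: X * Theta]
  (fun z : X * Theta => p z.2 z.1 * prior z.2).
Proof. by apply: measurable_funM => //; exact: (measurableT_comp prior_meas). Qed.

Let joint_ge0 theta x : 0 <= p theta x * prior theta.
Proof. exact: mulr_ge0. Qed.

Lemma marginal_ge0 x : (0 <= m x)%E.
Proof. by apply: integral_ge0 => theta _; rewrite lee_fin. Qed.

Lemma measurable_marginal : measurable_fun setT m.
Proof.
exact: (measurable_partial_integral nu
  (F := fun z : X * Theta => (p z.2 z.1 * prior z.2)%:E)
  (measurableT_comp _ joint_meas)).
Qed.

Lemma integral_likelihood_prior theta :
  (\int[mu]_x ((p theta x)%:E * (prior theta)%:E) = (prior theta)%:E)%E.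
Proof.
have [mp p0 p1] := p_density theta.
rewrite ge0_integralZr//; first by rewrite p1 mul1e.
- exact/measurable_EFinP.
- by move=> x _; rewrite lee_fin.
- by rewrite lee_fin.
Qed.

Lemma integral_marginal : (\int[mu]_x m x = 1)%E.
Proof.
have [_ _ prior1] := prior_density.
rewrite (fubini_tonelli (fun z : X * Theta => (p z.2 z.1 * prior z.2)%:E))/=.
- rewrite -[RHS]prior1; apply: eq_integral => theta _.
  by under eq_integral do rewrite EFinM; exact: integral_likelihood_prior.
- exact/measurable_EFinP.
- by move=> z; rewrite lee_fin.
Qed.

Lemma ae_marginal_lty : {ae mu, forall x, (m x < +oo)%E}.
Proof.
have : mu.-integrable setT m.
  apply/integrableP; split; first exact: measurable_marginal.
  under eq_integral do rewrite gee0_abs ?marginal_ge0//.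
  by rewrite integral_marginal ltry.
move=> /(integrable_ae measurableT); apply: filterS => x /(_ I).
by rewrite ge0_fin_numE// marginal_ge0.
Qed.

(** Since [0^-1 = 0], one formula covers both branches of [posterior], and it is
    visibly jointly measurable. *)
Lemma posteriorE x theta :
  post x theta = p theta x * prior theta * (fine (m x))^-1.
Proof.
rewrite /posterior; case: ifPn => //; rewrite -leNgt => m0.
by rewrite (_ : m x = 0%E) ?invr0 ?mulr0//; apply/eqP; rewrite eq_le m0 marginal_ge0.
Qed.

Lemma posterior_ge0 x theta : 0 <= post x theta.
Proof. by rewrite posteriorE mulr_ge0// invr_ge0 fine_ge0// marginal_ge0. Qed.

Lemma measurable_posterior :
  measurable_fun [set: X * Theta] (fun z : X * Theta => post z.1 z.2).
Proof.
(* The inverse is written as a real power, a measurable function. *)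
under eq_fun do rewrite posteriorE -powR_inv1 ?fine_ge0 ?marginal_ge0//.
apply: measurable_funM => //.
have mfine := @fine_measurable R setT measurableT.
have minv : measurable_fun setT (fun x => (fine (m x)) `^ (-1)).
  apply: (measurableT_comp (measurable_powR (-1))).
  exact: (measurableT_comp mfine measurable_marginal).
exact: (measurableT_comp minv).
Qed.

Lemma posterior_marginal x theta : (0 < m x < +oo)%E ->
  ((post x theta)%:E * m x = (p theta x)%:E * (prior theta)%:E)%E.
Proof.
rewrite posteriorE => /andP[]; case: (m x) => //= r r0 _.
by rewrite -!EFinM mulfVK// gt_eqF.
Qed.

(** Only an inequality, because [posterior] is 0 where the marginal is 0 or
    infinite; it holds at every point, which is what makes the posterior
    kernel map the weight [m] below the prior. *)
Lemma posterior_marginal_le x theta :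
  ((post x theta)%:E * m x <= (p theta x)%:E * (prior theta)%:E)%E.
Proof.
have pp0 : (0 <= (p theta x)%:E * (prior theta)%:E)%E by rewrite -EFinM lee_fin.
have [m0|m0] := eqVneq (m x) 0%E; first by rewrite m0 mule0.
have [moo|moo] := eqVneq (m x) +oo%E.
  by rewrite posteriorE moo/= invr0 mulr0 mul0e.
by rewrite posterior_marginal// lt0e m0 marginal_ge0 ltey.
Qed.

Lemma integral_posterior_le1 x : (\int[nu]_theta (post x theta)%:E <= 1)%E.
Proof.
have mj : measurable_fun setT (fun theta => (p theta x * prior theta)%:E).
  exact/measurable_EFinP/(measurableT_comp joint_meas (pair1_measurable x)).
under eq_integral do rewrite posteriorE EFinM.
rewrite ge0_integralZr//; last 2 first.
- by move=> theta _; rewrite lee_fin.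
- by rewrite lee_fin invr_ge0 fine_ge0// marginal_ge0.
rewrite -[(\int[nu]_x0 _)%E]/(m x).
have := marginal_ge0 x; case: (m x) => [r| |] //= r0; last by rewrite invr0 mule0.
rewrite -EFinM lee_fin; have [->|r_neq0] := eqVneq r 0; first by rewrite mul0r.
by rewrite mulfV.
Qed.

(** Where the marginal is 0, the joint density vanishes for almost every
    [theta]; where it is infinite, [x] lies in a null set. *)
Lemma bayes_rule : {ae mu, forall x, {ae nu, forall theta,
  ((p theta x)%:E * (prior theta)%:E = (post x theta)%:E * m x)%E}}.
Proof.
apply: filterS ae_marginal_lty => x moo.
have [m0|m0] := eqVneq (m x) 0%E; last first.
  by apply: aeW => theta; rewrite posterior_marginal// lt0e m0 marginal_ge0.
have mj : measurable_fun setT (fun theta => (p theta x * prior theta)%:E).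
  exact/measurable_EFinP/(measurableT_comp joint_meas (pair1_measurable x)).
have : (\int[nu]_theta `|(p theta x * prior theta)%:E| = 0)%E.
  by rewrite -m0; apply: eq_integral => theta _; rewrite gee0_abs// lee_fin.
move=> /(ae_eq_integral_abs nu measurableT mj); apply: filterS => theta /(_ I).
by rewrite m0 mule0 -EFinM.
Qed.

End BayesModel.

Theorem mainTheorem1 (R : realType) (dX dT : measure_display)
    (X : measurableType dX) (Theta : measurableType dT)
    (mu : {sigma_finite_measure set X -> \bar R})
    (nu : {sigma_finite_measure set Theta -> \bar R})
    (p : Theta -> X -> R) (prior : Theta -> R)
    (p_meas : measurable_fun [set: X * Theta]
                (fun z : X * Theta => p z.2 z.1))
    (p_density : forall theta : Theta, is_density mu (p theta))
    (prior_density : is_density nu prior)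
    (p_sq : (\int[nu]_theta \int[mu]_x
               ((p theta x) ^+ 2 * (p theta x * prior theta))%:E < +oo)%E) :
  let m := marginal nu p prior in
  let U := unbiasedness mu p in
  let B := Bayes nu p prior in
  [/\ (forall delta, Delta_marginal mu nu p prior delta ->
         {ae weighted nu (EFin \o prior), forall theta,
            mu.-integrable setT (fun x => (delta x * p theta x)%:E)}),
      (forall gamma, Gamma_prior nu prior gamma ->
         {ae weighted mu m, forall x,
            nu.-integrable setT
              (fun theta => (gamma theta * posterior nu p prior x theta)%:E)}),
      is_operator mu m nu (EFin \o prior) U,
      is_operator nu (EFin \o prior) mu m B &
      forall gamma delta,
        Gamma_prior nu prior gamma -> Delta_marginal mu nu p prior delta ->
        inner_prior nu prior gamma (U delta) =
        inner_marginal mu nu p prior (B gamma) delta].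
Proof.
move=> m U B; have [prior_meas prior_ge0 _] := prior_density.
have mp : measurable_fun [set: Theta * X] (fun z : Theta * X => p z.1 z.2).
  exact: (measurableT_comp p_meas (@measurable_swap _ _ Theta X)).
have p0 theta x : 0 <= p theta x by have [] := p_density theta.
have p1 theta : (\int[mu]_x (p theta x)%:E <= 1)%E.
  by have [_ _ ->] := p_density theta.
have mprior : measurable_fun setT (EFin \o prior) by exact/measurable_EFinP.
have prior0 theta : (0 <= (EFin \o prior) theta)%E by rewrite lee_fin.
have mm : measurable_fun setT m by exact: measurable_marginal.
have m0 x : (0 <= m x)%E by exact: marginal_ge0.
have mpost := measurable_posterior p_meas p_density prior_density.
have post0 := posterior_ge0 p_density prior_density.
have post1 := integral_posterior_le1 p_meas p_density prior_density.
have p_prior x : (\int[nu]_theta ((p theta x)%:E * (EFin \o prior) theta) <= m x)%E.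
  by rewrite /m/marginal; under [leRHS]eq_integral do rewrite EFinM.
have post_m theta : (\int[mu]_x ((posterior nu p prior x theta)%:E * m x) <=
    (EFin \o prior) theta)%E.
  rewrite /= -(integral_likelihood_prior p_density prior_density).
  apply: ge0_le_integral => //.
  - by move=> x _; rewrite mule_ge0// lee_fin.
  - apply: emeasurable_funM => //; apply/measurable_EFinP.
    exact: (measurableT_comp mpost (pair2_measurable theta)).
  - apply: emeasurable_funM; last exact: measurable_cst.
    by apply/measurable_EFinP; have [] := p_density theta.
  - by move=> x _; exact: posterior_marginal_le.
split.
- move=> delta; exact: (ae_integrable_kernel_op mp p0 p1 mprior prior0 mm p_prior).
- move=> gamma.
  exact: (ae_integrable_kernel_op mpost post0 post1 mm m0 mprior post_m).
- exact: (kernel_op_is_operator mp p0 p1 mprior prior0 mm m0 p_prior).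
- exact: (kernel_op_is_operator mpost post0 post1 mm m0 mprior prior0 post_m).
- move=> gamma delta Lgamma Ldelta.
  apply: (kernel_op_adjoint mp mpost p0 post0 p1 post1 mprior prior0 mm m0
    p_prior post_m) Ldelta Lgamma => //.
  + by apply: aeW => theta; rewrite /= ltry.
  + exact: ae_marginal_lty p_meas p_density prior_density.
  + exact: bayes_rule p_meas p_density prior_density.
Qed.
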